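(* Let $\mathbb{F}$ be a finite field with $q$ elements, let $\lambda\in\mathbb{F}$, and consider the trace algebra $(\mathbb{F}\cdot1+\mathbb{F}v,\lambda)$, where $v^2=0$ and the trace is the $\mathbb{F}$-linear map with $t(1)=\lambda$ and $t(v)=1$. Then $\mathrm{Id}(\mathbb{F}\cdot1+\mathbb{F}v,\lambda)$ follows from (that is, is equal to the T-ideal generated by) the following polynomials: (i) $t(1)-\lambda$; (ii) $t(x^q)-t(1)x^q$; (iii) $(x^q-x)^2$; (iv) $t(x)^q-t(x)$; (v) $t(x-x^q)^{q-1}(x-x^q)-(x-x^q)$; (vi) all Capelli polynomials of order $3$.
   Context: Algebras are associative over $\mathbb{F}$. A trace on an algebra $\mathcal{A}$ is an $\mathbb{F}$-linear map $t:\mathcal{A}\to\mathcal{A}$ such that for all $a,b$: $t(a)\in Z(\mathcal{A})$, $t(ab)=t(ba)$, $t(t(a)b)=t(a)t(b)$. A trace algebra is an algebra with a trace. $\mathbb{F}\cdot1+\mathbb{F}v$ is $\mathbb{F}[\xi]/\langle\xi^2\rangle$ with $v$ the class of $\xi$; scalars are identified with multiples of $1$. $\mathbb{F}\langle X,t\rangle$ denotes the free unital associative trace algebra freely generated by an infinite set $X$ of variables, i.e. the free algebra of the variety of unital associative algebras with a linear unary operation $t$ satisfying $t(x)y=yt(x)$, $t(xy)=t(yx)$, $t(t(x)y)=t(x)t(y)$ (here $t(1)$ is not assumed to be a scalar). For a unital trace algebra $(\mathcal{A},t)$, $\mathrm{Id}(\mathcal{A},t)\subseteq\mathbb{F}\langle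 X,t\rangle$ is the set of all trace polynomials vanishing under every substitution of the variables by elements of $\mathcal{A}$. A T-ideal is a two-sided ideal of $\mathbb{F}\langle X,t\rangle$ closed under $t$ and under all (trace-algebra) endomorphisms of $\mathbb{F}\langle X,t\rangle$; $\langle S\rangle$ is the smallest T-ideal containing $S$. ''$\mathrm{Id}(\mathcal{A},t)$ follows from $S$'' means $\mathrm{Id}(\mathcal{A},t)=\langle S\rangle$. A Capelli polynomial of order $m$ is a multilinear polynomial $f(x_1,\ldots,x_m,y_1,\ldots,y_r)\in\mathbb{F}\langle X,t\rangle$ that is alternating in $\{x_1,\ldots,x_m\}$. In the paper, each Capelli polynomial of order $m$ is a consequence of $[x,y]=xy-yx$ and the single polynomial $\sum_{\sigma\in\mathcal{S}_m}(-1)^\sigma t(y_1x_{\sigma(1)})\cdots t(y_{m-1}x_{\sigma(m-1)})y_mx_{\sigma(m)}$, where $(-1)^\sigma$ is the sign of $\sigma$. *)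

(* Defs.v *)
From HB Require Import structures.
From mathcomp Require Import all_boot all_order all_algebra qpoly.
From mathcomp Require Import boolp classical_sets cardinality.

Set Warnings "-redundant-canonical-projection".
Set Implicit Arguments.
Unset Strict Implicit.
Unset Printing Implicit Defensive.

Import GRing.Theory.
Local Open Scope ring_scope.
Local Open Scope classical_set_scope.

HB.mixin Record Algebra_hasTrace (F : fieldType) A of GRing.Algebra F A := {
  trace : A -> A;
  trace_linear : linear trace;
  trace_central : forall a b, trace a * b = b * trace a;
  traceM_comm : forall a b, trace (a * b) = trace (b * a);
  traceM_trace : forall a b, trace (trace a * b) = trace a * trace b
}.

#[short(type="traceAlgType")]
HB.structure Definition TraceAlgebra (F : fieldType) :=
  {A of GRing.Algebra F A & Algebra_hasTrace F A}.

HB.instance Definition _ (F : fieldType) (A : traceAlgType F) :=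
  GRing.isLinear.Build F A A *:%R (@trace F A) trace_linear.

(* [lambda] is a phantom parameter of the carrier; it selects the trace. *)
Definition dual_numbers (F : fieldType) (lambda : F) : Type :=
  {poly %/ ('X^2 : {poly F})}.

Section DualNumbers.
Variables (F : fieldType) (lambda : F).
Local Notation D := (dual_numbers lambda).

HB.instance Definition _ := GRing.ComUnitAlgebra.on D.

Definition dual_v : D := 'qX.

Definition dual_trace (a : D) : D :=
  (lambda * (a : {poly F})`_0 + (a : {poly F})`_1)%:A.

Fact dual_trace_linear : linear dual_trace.
Proof.
move=> c a b; rewrite /dual_trace scalerA -scalerDl; congr (_ *: _).
by rewrite !coefD !coefZ !mulrDr mulrCA addrACA.
Qed.

Fact dual_trace_trace (a b : D) :
  dual_trace (dual_trace a * b) = dual_trace a * dual_trace b.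
Proof.
rewrite /dual_trace -!scalerAl !mul1r scalerA; congr (_ *: _).
by rewrite !coefZ mulrCA -mulrDr.
Qed.

HB.instance Definition _ := Algebra_hasTrace.Build F D dual_trace_linear
  (fun a b => mulrC (dual_trace a) b)
  (fun a b => congr1 dual_trace (mulrC a b)) dual_trace_trace.

Fact dual_vE : dual_v = 'X :> {poly F}.
Proof. by rewrite qpolyXE ?size_polyXn ?monicXn. Qed.

Lemma dual_v_sqr : dual_v ^+ 2 = 0.
Proof.
suff: ('qX : {poly %/ ('X^2 : {poly F})}) ^+ 2 = 0 by [].
apply: val_inj; apply: etrans (poly_of_qpolyX _ 2) _; rewrite -/dual_v dual_vE.
by rewrite {1}(esym (mk_monic_Xn F 2)) Pdiv.RingMonic.rmodpp ?monic_mk_monic.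
Qed.

Lemma trace_dual1 : trace (1 : D) = lambda%:A.
Proof.
rewrite [LHS]/(dual_trace 1) /dual_trace; congr (_ *: _).
by rewrite /= !coefC mulr1 addr0.
Qed.

Lemma trace_dual_v : trace dual_v = 1.
Proof.
rewrite [LHS]/(dual_trace dual_v) /dual_trace dual_vE !coefX mulr0 add0r.
by rewrite scale1r.
Qed.

Lemma dual_span (a : D) : exists c d : F, a = c%:A + d *: dual_v.
Proof.
exists (a : {poly F})`_0, (a : {poly F})`_1; apply/npolyP => i.
set c := _`_0; set d := _`_1.
have E : polyn (c%:A + d *: dual_v) = c *: 1 + d *: polyn dual_v :> {poly F}.
  by [].
apply: etrans (congr1 (fun p : {poly F} => p`_i) (esym E)).
rewrite dual_vE coefD !coefZ coef1 coefX {E}/c {}/d.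
case: i => [|[|i]]; rewrite ?mulr1 ?mulr0 ?addr0 ?add0r // nth_default //.
by rewrite (leq_trans (size_npoly a)) // mk_monic_Xn size_polyXn.
Qed.

End DualNumbers.

Inductive tterm (F X : Type) : Type :=
| TVar of X
| TConst of F
| TAdd of tterm F X & tterm F X
| TMul of tterm F X & tterm F X
| TTrace of tterm F X.

Arguments TVar {F X}.
Arguments TConst {F X}.

HB.instance Definition _ (F X : Type) := gen_eqMixin (tterm F X).
HB.instance Definition _ (F X : Type) := gen_choiceMixin (tterm F X).

Fixpoint tinterp (F : fieldType) (X : Type) (A : traceAlgType F) (e : X -> A)
    (p : tterm F X) : A :=
  match p with
  | TVar x => e x
  | TConst c => c%:A
  | TAdd p1 p2 => tinterp e p1 + tinterp e p2
  | TMul p1 p2 => tinterp e p1 * tinterp e p2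
  | TTrace p1 => trace (tinterp e p1)
  end.

(* Terms are identified when they agree in every unital trace algebra: this is
   the free algebra of the variety, cf. [teval] and [teval_unique]. *)
Definition tequiv (F : fieldType) (X : Type) (p1 p2 : tterm F X) : bool :=
  `[< forall (A : traceAlgType F) (e : X -> A), tinterp e p1 = tinterp e p2 >].

Section FreeTraceAlgebra.
Variables (F : fieldType) (X : Type).

Fact tequiv_refl : reflexive (@tequiv F X).
Proof. by move=> p; apply/asboolP. Qed.

Fact tequiv_sym : symmetric (@tequiv F X).
Proof.
move=> p1 p2; apply/asboolP/asboolP => h A e; by rewrite h.
Qed.

Fact tequiv_trans : transitive (@tequiv F X).
Proof.
move=> p2 p1 p3 /asboolP h12 /asboolP h23; apply/asboolP => A e.
by rewrite h12.
Qed.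

Canonical tequiv_equiv := EquivRel (@tequiv F X) tequiv_refl tequiv_sym tequiv_trans.

Definition free_trace_alg : Type := {eq_quot tequiv_equiv}%qT.

HB.instance Definition _ := Choice.on free_trace_alg.
HB.instance Definition _ := Quotient.on free_trace_alg.

Local Notation W := free_trace_alg.

Definition teval (A : traceAlgType F) (e : X -> A) (f : W) : A :=
  tinterp e (repr f).


Let cls (p : tterm F X) : W := (\pi_W p)%qT.

Fact teval_pi (A : traceAlgType F) (e : X -> A) p :
  teval e (cls p) = tinterp e p.
Proof.
rewrite /teval; have h : cls (repr (cls p)) = cls p by exact: reprK.
by move/(@eqquotP _ tequiv_equiv {eq_quot tequiv_equiv}%qT)/asboolP: h; apply.
Qed.

Fact tevalP (f g : W) :
  (forall (A : traceAlgType F) (e : X -> A), teval e f = teval e g) -> f = g.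
Proof.
move=> h; rewrite -[f]reprK -[g]reprK.
by apply/(@eqquotP _ tequiv_equiv {eq_quot tequiv_equiv}%qT)/asboolP => A e; exact: h.
Qed.

Definition fvar (x : X) : W := cls (TVar x).
Definition fconst (c : F) : W := cls (TConst c).
Definition fadd (f g : W) : W := cls (TAdd (repr f) (repr g)).
Definition fmul (f g : W) : W := cls (TMul (repr f) (repr g)).
Definition fopp (f : W) : W := fmul (fconst (-1)) f.
Definition fscale (c : F) (f : W) : W := fmul (fconst c) f.
Definition ftrace (f : W) : W := cls (TTrace (repr f)).

Section Eval.
Variables (A : traceAlgType F) (e : X -> A).
Fact teval_var x : teval e (fvar x) = e x. Proof. exact: teval_pi. Qed.
Fact teval_const c : teval e (fconst c) = c%:A. Proof. exact: teval_pi. Qed.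
Fact teval_add f g : teval e (fadd f g) = teval e f + teval e g.
Proof. exact: teval_pi. Qed.
Fact teval_mul f g : teval e (fmul f g) = teval e f * teval e g.
Proof. exact: teval_pi. Qed.
Fact teval_opp f : teval e (fopp f) = - teval e f.
Proof. by rewrite teval_mul teval_const scaleN1r mulN1r. Qed.
Fact teval_scale c f : teval e (fscale c f) = c *: teval e f.
Proof. by rewrite teval_mul teval_const -scalerAl mul1r. Qed.
Fact teval_trace f : teval e (ftrace f) = trace (teval e f).
Proof. exact: teval_pi. Qed.
End Eval.

Let tevalE := (teval_var, teval_const, teval_add, teval_opp, teval_scale,
  teval_trace, teval_mul, scale0r, scale1r).

Fact fadd_assoc : associative fadd.
Proof. by move=> f g h; apply: tevalP => A e; rewrite !tevalE addrA. Qed.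
Fact fadd_comm : commutative fadd.
Proof. by move=> f g; apply: tevalP => A e; rewrite !tevalE addrC. Qed.
Fact fadd_0l : left_id (fconst 0) fadd.
Proof. by move=> f; apply: tevalP => A e; rewrite !tevalE add0r. Qed.
Fact fadd_Nl : left_inverse (fconst 0) fopp fadd.
Proof. by move=> f; apply: tevalP => A e; rewrite !tevalE addNr. Qed.

HB.instance Definition _ :=
  GRing.isZmodule.Build W fadd_assoc fadd_comm fadd_0l fadd_Nl.

Fact fmul_assoc : associative fmul.
Proof. by move=> f g h; apply: tevalP => A e; rewrite !tevalE mulrA. Qed.
Fact fmul_1l : left_id (fconst 1) fmul.
Proof. by move=> f; apply: tevalP => A e; rewrite !tevalE mul1r. Qed.
Fact fmul_1r : right_id (fconst 1) fmul.
Proof. by move=> f; apply: tevalP => A e; rewrite !tevalE mulr1. Qed.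
Fact fmul_Dl : left_distributive fmul +%R.
Proof. by move=> f g h; apply: tevalP => A e; rewrite !tevalE mulrDl. Qed.
Fact fmul_Dr : right_distributive fmul +%R.
Proof. by move=> f g h; apply: tevalP => A e; rewrite !tevalE mulrDr. Qed.
Fact fone_neq0 : fconst 1 != 0.
Proof.
apply/eqP => /(congr1 (teval (fun=> 0 : dual_numbers (0 : F)))) /eqP.
by rewrite !tevalE oner_eq0.
Qed.

HB.instance Definition _ := GRing.Zmodule_isNzRing.Build W
  fmul_assoc fmul_1l fmul_1r fmul_Dl fmul_Dr fone_neq0.

Fact fscale_A (c d : F) f : fscale c (fscale d f) = fscale (c * d) f.
Proof. by apply: tevalP => A e; rewrite !tevalE scalerA. Qed.
Fact fscale_1 : left_id 1 fscale.
Proof. by move=> f; apply: tevalP => A e; rewrite !tevalE. Qed.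
Fact fscale_Dr : right_distributive fscale +%R.
Proof. by move=> c f g; apply: tevalP => A e; rewrite !tevalE scalerDr. Qed.
Fact fscale_Dl f : {morph fscale^~ f : c d / c + d}.
Proof. by move=> c d; apply: tevalP => A e; rewrite !tevalE scalerDl. Qed.

HB.instance Definition _ := GRing.Zmodule_isLmodule.Build F W
  fscale_A fscale_1 fscale_Dr fscale_Dl.

Fact fscale_Al c (f g : W) : c *: (f * g) = (c *: f) * g.
Proof. by apply: tevalP => A e; rewrite !tevalE scalerAl. Qed.
Fact fscale_Ar c (f g : W) : c *: (f * g) = f * (c *: g).
Proof. by apply: tevalP => A e; rewrite !tevalE scalerAr. Qed.

HB.instance Definition _ := GRing.Lmodule_isLalgebra.Build F W fscale_Al.
HB.instance Definition _ := GRing.Lalgebra_isAlgebra.Build F W fscale_Ar.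

Fact ftrace_linear : linear ftrace.
Proof. by move=> c f g; apply: tevalP => A e; rewrite !tevalE linearP. Qed.
Fact ftrace_central (f g : W) : ftrace f * g = g * ftrace f.
Proof. by apply: tevalP => A e; rewrite !tevalE trace_central. Qed.
Fact ftraceM_comm (f g : W) : ftrace (f * g) = ftrace (g * f).
Proof. by apply: tevalP => A e; rewrite !tevalE traceM_comm. Qed.
Fact ftraceM_trace (f g : W) : ftrace (ftrace f * g) = ftrace f * ftrace g.
Proof. by apply: tevalP => A e; rewrite !tevalE traceM_trace. Qed.

HB.instance Definition _ := Algebra_hasTrace.Build F W
  ftrace_linear ftrace_central ftraceM_comm ftraceM_trace.

Section EvalMorphism.
Variables (A : traceAlgType F) (e : X -> A).

Fact teval_linear : linear (teval e : W -> A).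
Proof. by move=> c f g; rewrite !tevalE. Qed.

Fact teval_monoid_morphism : monoid_morphism (teval e : W -> A).
Proof. by split=> [|f g]; rewrite !tevalE. Qed.

HB.instance Definition _ :=
  GRing.isLinear.Build F W A *:%R (teval e : W -> A) teval_linear.
HB.instance Definition _ :=
  GRing.isMonoidMorphism.Build W A (teval e : W -> A) teval_monoid_morphism.

Lemma teval_unique (phi : {lrmorphism W -> A}) :
    (forall f, phi (trace f) = trace (phi f)) ->
    (forall x, phi (fvar x) = e x) ->
  phi =1 teval e.
Proof.
move=> phit phix f; rewrite -[f]reprK.
elim: (repr f) => {f} [x|c|p IHp q IHq|p IHp q IHq|p IHp].
- by rewrite phix teval_var.
- have -> : (\pi_W (TConst c))%qT = c%:A :> W.
    by apply: tevalP => B b; rewrite teval_pi !tevalE.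
  by rewrite !linearZ !rmorph1.
- have -> : (\pi_W (TAdd p q))%qT = (\pi_W p)%qT + (\pi_W q)%qT :> W.
    by apply: tevalP => B b; rewrite !tevalE !teval_pi.
  by rewrite !linearD /= IHp IHq.
- have -> : (\pi_W (TMul p q))%qT = (\pi_W p)%qT * (\pi_W q)%qT :> W.
    by apply: tevalP => B b; rewrite !tevalE !teval_pi.
  by rewrite !rmorphM /= IHp IHq.
have -> : (\pi_W (TTrace p))%qT = trace (\pi_W p)%qT :> W.
  by apply: tevalP => B b; rewrite !tevalE !teval_pi.
by rewrite phit IHp teval_trace.
Qed.

End EvalMorphism.
End FreeTraceAlgebra.

Arguments fvar {F X} x.

Section TIdeals.
Variables (F : fieldType) (X : Type).
Local Notation W := (free_trace_alg F X).

Record T_ideal (I : set W) : Prop := {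
  T_ideal0 : I 0;
  T_idealD : forall f g, I f -> I g -> I (f + g);
  T_idealMl : forall f g, I g -> I (f * g);
  T_idealMr : forall f g, I f -> I (f * g);
  T_ideal_trace : forall f, I f -> I (trace f);
  T_ideal_endo : forall phi : {lrmorphism W -> W},
    (forall f, phi (trace f) = trace (phi f)) -> forall f, I f -> I (phi f)
}.

Definition T_ideal_generated (S : set W) : set W := smallest T_ideal S.

Definition trace_identities (A : traceAlgType F) : set W :=
  [set f | forall e : X -> A, teval e f = 0].

End TIdeals.

Arguments trace_identities {F} X A.

Section Capelli.
Variables (F : fieldType) (X : choiceType).
Local Notation W := (free_trace_alg F X).

Definition word (w : seq X) : W := \prod_(x <- w) fvar x.

(* Words of [ws] may be empty: powers of [trace 1] are allowed as factors. *)
Definition trace_monomial (w : seq X) (ws : seq (seq X)) : W :=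
  word w * \prod_(u <- ws) trace (word u).

(* [f] is multilinear in exactly the pairwise distinct variables [s]: a linear
   combination of trace monomials in each of which every variable of [s], and
   no other one, occurs exactly once. *)
Definition multilinear (s : seq X) (f : W) : Prop :=
  uniq s /\
  exists (n : nat) (c : 'I_n -> F) (w : 'I_n -> seq X)
         (ws : 'I_n -> seq (seq X)),
    (forall i, perm_eq (w i ++ flatten (ws i)) s) /\
    f = \sum_(i < n) c i *: trace_monomial (w i) (ws i).

(* Alternation means vanishing when two of the variables are identified;
   a mere change of sign under transpositions is weaker in characteristic 2. *)
Definition alternating (xs : seq X) (f : W) : Prop :=
  {in xs &, forall x y, x != y ->
    teval (fun z => fvar (if z == y then x else z) : W) f = 0}.

Definition capelli (m : nat) (f : W) : Prop :=
  exists xs ys : seq X,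
    [/\ size xs = m, multilinear (xs ++ ys) f & alternating xs f].

End Capelli.

(* Main.v *)
Require Import Defs.
From HB Require Import structures.
From mathcomp Require Import all_boot all_order all_algebra all_field qpoly.
From mathcomp Require Import ring zify.
From mathcomp Require Import boolp classical_sets cardinality.

Set Implicit Arguments.
Unset Strict Implicit.
Unset Printing Implicit Defensive.

Import GRing.Theory.
Local Open Scope ring_scope.
Local Open Scope classical_set_scope.

(** Write A for the dual numbers and q for the number of elements of F.

    That A satisfies the listed polynomials is a computation, since
    (c + d v)^q = c and t(c + d v) = lambda c + d; a Capelli polynomial of
    order 3 vanishes because A is spanned by the two elements 1 and v, so that
    by multilinearity only substitutions repeating a basis element remain
    ([capelli_identity]).

    Conversely, dividing the free trace algebra by the T-ideal generated by the
    list, it is enough to show that every trace algebra B satisfying the list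
    satisfies all identities of A ([T_ideal_of_quotients]).  The standard
    polynomial of degree 3 with one argument set to 1 is a commutator, so B is
    commutative, and x |-> x^q is an F-algebra endomorphism of B.  By (iii) it
    is idempotent: B is the direct sum of the subalgebra C of the c with
    c^q = c and of the ideal N of the n with n^q = 0.  By (ii) the trace is
    lambda on C, and by (v) an n in N equals t(n)^(q-1) n, so n is determined
    by t(n), which lies in C by (iv).  The one trace Capelli polynomial

      sum over s of sign(s) t(x_s(1)) t(y x_s(2)) x_s(3),

    evaluated with y = n at the triples (1, c, n) and (1, n, m), shows that t
    is C-linear on N ([trace_mul_fix]) and that N N = 0 ([nil_mul]).  Hence
    c + n |-> c + t(n) v embeds B, as a trace algebra, into the dual numbers
    over C (its components are b^q and t(b - b^q), see [frob_mul_trace],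
    [traceE] and [coords_inj]).

    Finally C is a subring of a product of copies of F.  Instead of choosing
    prime ideals, one uses that 1 - (c - alpha)^(q-1) behaves on C as the
    indicator of c = alpha: an element killed by all of these indicators is 0
    ([indicator_split]).  Given a trace polynomial, products of the indicators
    for the finitely many components of its variables reduce its evaluation in
    B to its evaluations in A ([match_interp], [match_cover]), which are 0 when
    it is an identity of A. *)

(** * Finite fields and dual numbers *)

(** What makes x |-> x^q additive on commutative F-algebras. *)
Lemma card_pnat (F : finFieldType) (R : lalgType F) : [pchar R].-nat #|F|.
Proof.
have [p p_pr chFp] := finPcharP F.
rewrite (eq_pnat _ (pchar_lalg R)) (eq_pnat _ (pcharf_eq chFp)).
by have := card_pprimeChar chFp; rewrite /= => ->; rewrite pnatX pnat_id.
Qed.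

Lemma card_ge2 (F : finFieldType) : {m | #|F| = m.+2}.
Proof. by exists #|F|.-2; case: #|F| (card_finNzRing_gt1 F) => [|[|m]]. Qed.

Lemma dual_frob (F : finFieldType) (lambda c d : F) :
  (c%:A + d *: dual_v lambda) ^+ #|F| = c%:A.
Proof.
rewrite exprDn_pchar; last exact: card_pnat.
rewrite !exprZn !expf_card expr1n; have [m ->] := card_ge2 F.
by rewrite -addn2 exprD dual_v_sqr mulr0 scaler0 addr0.
Qed.

Lemma dual_trace_coords (F : fieldType) (lambda c d : F) :
  trace (c%:A + d *: dual_v lambda) = (lambda * c + d)%:A.
Proof.
by rewrite linearD !linearZ /= trace_dual1 trace_dual_v scalerA scalerDl mulrC.
Qed.

Lemma dual_coords_inj (F : fieldType) (lambda a0 a1 : F) :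
  a0%:A + a1 *: dual_v lambda = 0 -> a0 = 0 /\ a1 = 0.
Proof.
move=> a_0; have a00 : a0 = 0.
  have /(congr1 trace) : (a0%:A + a1 *: dual_v lambda) * dual_v lambda = 0.
    by rewrite a_0 mul0r.
  rewrite mulrDl -!scalerAl -expr2 dual_v_sqr scaler0 addr0 mul1r.
  rewrite linearZ linear0.
  rewrite /= trace_dual_v => /eqP; rewrite scaler_eq0 oner_eq0 orbF.
  by move/eqP.
split=> //; move/(congr1 trace): a_0; rewrite a00 scale0r add0r linearZ linear0.
rewrite /= trace_dual_v => /eqP; rewrite scaler_eq0 oner_eq0 orbF.
by move/eqP.
Qed.

(** * Evaluation of trace polynomials *)

Section TraceMorphisms.
Variables (F : fieldType) (X : Type).
Local Notation W := (free_trace_alg F X).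

Lemma teval_comp (A B : traceAlgType F) (phi : {lrmorphism A -> B})
    (e : X -> A) :
  (forall a, phi (trace a) = trace (phi a)) ->
  forall f : W, phi (teval e f) = teval (phi \o e) f.
Proof.
move=> phit; rewrite /teval => f.
elim: (repr f) => //= [c|p IHp r IHr|p IHp r IHr|p IHp].
- by rewrite linearZ rmorph1.
- by rewrite linearD /= IHp IHr.
- by rewrite rmorphM /= IHp IHr.
by rewrite phit IHp.
Qed.

Lemma teval_endo (B : traceAlgType F) (d : X -> B) (e : X -> W) (f : W) :
  teval d (teval e f) = teval (fun x => teval d (e x)) f.
Proof. by rewrite teval_comp // => a; rewrite [LHS]teval_trace. Qed.

Lemma T_ideal_identities (A : traceAlgType F) : T_ideal (trace_identities X A).
Proof.
split=> [e|f g If Ig e|f g Ig e|f g If e|f If e|phi phit f If e].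
- by rewrite linear0.
- by rewrite linearD /= If Ig addr0.
- by rewrite rmorphM /= Ig mulr0.
- by rewrite rmorphM /= If mul0r.
- by rewrite teval_trace If linear0.
by rewrite (teval_unique phit (fun=> erefl)) teval_endo If.
Qed.

End TraceMorphisms.

(** * Capelli polynomials vanish on dual numbers *)

Section CapelliVanish.
Variables (F : fieldType) (X : choiceType) (A : traceAlgType F).
Local Notation W := (free_trace_alg F X).

Definition upd (e : X -> A) (x : X) (a : A) : X -> A :=
  fun z => if z == x then a else e z.

(** The degrees that occur in a multilinear monomial, counted with respect to
    one variable. *)
Definition degree_le1 (n : nat) (g : A -> A) : Prop :=
  match n with
  | 0 => forall a b, g a = g b
  | 1 => linear g
  | _ => True
  end.

Lemma degree_le1M n m g h : degree_le1 n g -> degree_le1 m h ->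
  degree_le1 (n + m) (fun a => g a * h a).
Proof.
case: n => [|[|n]]; case: m => [|[|m]] //=; rewrite ?addn0 //=.
- by move=> gC hC a b; rewrite (gC a b) (hC a b).
- move=> gC hL c a b; rewrite hL mulrDr scalerAr.
  by rewrite (gC (c *: a + b) a) {2}(gC a b).
- move=> gL hC c a b; rewrite gL mulrDl scalerAl.
  by rewrite (hC (c *: a + b) a) {2}(hC a b).
Qed.

Lemma degree_le1_trace n g :
  degree_le1 n g -> degree_le1 n (fun a => trace (g a)).
Proof.
case: n => [|[|n]] //= gP; first by move=> a b; rewrite (gP a b).
by move=> c a b; rewrite gP linearP.
Qed.

Lemma teval_word (e : X -> A) w : teval e (word F w) = \prod_(x <- w) e x.
Proof.
by rewrite /word rmorph_prod; apply: eq_bigr => x _; rewrite /= teval_var.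
Qed.

Lemma degree_le1_word e x w :
  degree_le1 (count_mem x w) (fun a => teval (upd e x a) (word F w)).
Proof.
elim: w => [|z w IHw] /=; first by move=> a b; rewrite !teval_word !big_nil.
have -> : (fun a => teval (upd e x a) (word F (z :: w))) =
          (fun a => upd e x a z * teval (upd e x a) (word F w)).
  by apply/funext => a; rewrite !teval_word big_cons.
apply: degree_le1M => //; rewrite /upd; case: eqP => //= _ a b.
Qed.

(** The number of occurrences of a variable in a trace monomial is its degree
    there, because degrees add up under products and the trace is linear. *)
Lemma degree_le1_monomial e x w ws :
  degree_le1 (count_mem x (w ++ flatten ws))
    (fun a => teval (upd e x a) (trace_monomial F w ws)).
Proof.
rewrite count_cat /trace_monomial.
under [X in degree_le1 _ X]funext do rewrite rmorphM.
apply: degree_le1M; first exact: degree_le1_word.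
elim: ws => [|u ws IHws] /=.
  by move=> a b; rewrite !big_nil !rmorph1.
under [X in degree_le1 _ X]funext do rewrite big_cons rmorphM /= teval_trace.
rewrite count_cat; apply: degree_le1M => //.
exact/degree_le1_trace/degree_le1_word.
Qed.

Lemma multilinear_linear e x s (f : W) : multilinear s f -> x \in s ->
  linear (fun a => teval (upd e x a) f).
Proof.
move=> [us [n [c [w [ws [ps ->]]]]]] xs k a b.
rewrite !linear_sum -big_split /=; apply: eq_bigr => i _.
have := degree_le1_monomial e x (w i) (ws i).
rewrite (permP (ps i)) count_uniq_mem // xs /= => h.
by rewrite !linearZ /= h scalerDr !scalerA mulrC.
Qed.

Lemma upd_id e x : upd e x (e x) = e.
Proof. by apply/funext => z; rewrite /upd; case: eqP => [->|]. Qed.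

End CapelliVanish.

Section CapelliDual.
Variables (F : fieldType) (lambda : F) (X : choiceType).
Local Notation W := (free_trace_alg F X).
Local Notation D := (dual_numbers lambda).

Definition dual_basis (b : bool) : D := if b then dual_v lambda else 1.

(** By linearity in x, it suffices to substitute basis elements for x. *)
Lemma dual_basis_ind e x s (f : W) : multilinear s f -> x \in s ->
  (forall b, teval (upd e x (dual_basis b)) f = 0) -> teval e f = 0.
Proof.
move=> fs xs f0; rewrite -(upd_id e x); have [c [d ->]] := dual_span (e x).
have fL := multilinear_linear e fs xs.
have /= f00 := fL (-1) 0 0; rewrite scaler0 addr0 scaleN1r addNr in f00.
by rewrite fL -[_ *: dual_v _]addr0 fL f00 (f0 true) (f0 false) !scaler0 !addr0.
Qed.

(** Alternation identifies variables, and evaluation at a point with equal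
    values factors through this identification. *)
Lemma alternating_eq xs (f : W) (e : X -> D) x y : alternating xs f ->
  x \in xs -> y \in xs -> x != y -> e x = e y -> teval e f = 0.
Proof.
move=> fA xxs yxs neq_xy exy.
have := congr1 (teval e) (fA x y xxs yxs neq_xy); rewrite linear0 => <-.
rewrite teval_endo; congr teval; apply/funext => z; rewrite teval_var.
by case: eqP => [->|].
Qed.

(** Three basis elements of a plane cannot be distinct. *)
Lemma capelli_identity (f : W) : capelli 3 f -> trace_identities X D f.
Proof.
move=> [[|x1 [|x2 [|x3 [|x4 s]]]] [ys [//= _ fs fA]]] e.
have [/= us _] := fs.
move: us; rewrite !inE !negb_or -!andbA => /and5P[n12 n13 _ n23 _].
apply: (dual_basis_ind fs (x := x1)) => [|b1]; first by rewrite !inE eqxx.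
apply: (dual_basis_ind fs (x := x2)) => [|b2]; first by rewrite !inE eqxx orbT.
apply: (dual_basis_ind fs (x := x3)) => [|b3]; first by rewrite !inE eqxx !orbT.
set e' := upd _ _ _.
have E1 : e' x1 = dual_basis b1.
  by rewrite /e' /upd (negPf n13) (negPf n12) eqxx.
have E2 : e' x2 = dual_basis b2 by rewrite /e' /upd (negPf n23) eqxx.
have E3 : e' x3 = dual_basis b3 by rewrite /e' /upd eqxx.
have [b12|b12] := eqVneq b1 b2.
  by apply: (alternating_eq fA _ _ n12);
    rewrite ?E1 ?E2 ?b12 // !inE eqxx ?orbT.
have [b13|b13] := eqVneq b1 b3.
  by apply: (alternating_eq fA _ _ n13);
    rewrite ?E1 ?E3 ?b13 // !inE eqxx ?orbT.
have b23 : b2 = b3 by move: b12 b13; case: b1 b2 b3 {E1 E2 E3 e'} => [] [] [].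
by apply: (alternating_eq fA _ _ n23); rewrite ?E2 ?E3 ?b23 // !inE eqxx ?orbT.
Qed.

End CapelliDual.

(** * Two Capelli polynomials and their consequences *)

Definition alt3 (T : Type) (U : zmodType) (g : T -> T -> T -> U) a b c : U :=
  g a b c - g b a c + g b c a - g c b a + g c a b - g a c b.

Section Alternation.
Variables (T : Type) (U : zmodType) (g : T -> T -> T -> U).

Lemma alt3_12 a c : alt3 g a a c = 0.
Proof. by rewrite /alt3 subrr add0r subrK subrr. Qed.

Lemma alt3_13 a b : alt3 g a b a = 0.
Proof. by rewrite /alt3 addrK subrK subrr. Qed.

Lemma alt3_23 a b : alt3 g a b b = 0.
Proof. by rewrite /alt3 addrK subrK subrr. Qed.

End Alternation.

Section CapelliExamples.
Variables (F : fieldType) (X : choiceType).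
Local Notation W := (free_trace_alg F X).

Lemma teval_rename (r : X -> X) w ws :
  teval (fun z => fvar (r z) : W) (trace_monomial F w ws) =
  trace_monomial F (map r w) (map (map r) ws).
Proof.
rewrite /trace_monomial rmorphM /= teval_word {2}/word big_map.
congr (_ * _); rewrite rmorph_prod big_map; apply: eq_bigr => u _.
by rewrite [LHS]teval_trace teval_word /word big_map.
Qed.

Lemma teval_alt3 (B : traceAlgType F) (e : X -> B) (g : X -> X -> X -> W)
    a b c :
  teval e (alt3 g a b c) = alt3 (fun a b c => teval e (g a b c)) a b c.
Proof. by rewrite /alt3 !(linearB, linearD). Qed.

(** The template of a Capelli polynomial: a trace monomial depending on three
    letters besides the fixed ones ys.  The last hypothesis says that it is
    natural in the letters, so that renamings can be computed in it. *)
Variables (w : X -> X -> X -> seq X) (ws : X -> X -> X -> seq (seq X)).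
Variable ys : seq X.
Hypothesis perm_w : forall a b c,
  perm_eq (w a b c ++ flatten (ws a b c)) ([:: a; b; c] ++ ys).
Hypothesis map_w : forall r : X -> X, {in ys, r =1 id} -> forall a b c,
  map r (w a b c) = w (r a) (r b) (r c) /\
  map (map r) (ws a b c) = ws (r a) (r b) (r c).

Lemma capelli_alt3 a b c : uniq ([:: a; b; c] ++ ys) ->
  capelli 3 (alt3 (fun a b c => trace_monomial F (w a b c) (ws a b c)) a b c).
Proof.
move=> uxs; exists [:: a; b; c], ys; split=> //.
  pose t := [:: (a, b, c); (b, a, c); (b, c, a);
    (c, b, a); (c, a, b); (a, c, b)].
  pose n3 T (f : X -> X -> X -> T) i :=
    let: (a, b, c) := nth (a, b, c) t i in f a b c.
  split=> //; exists 6, (fun i => (-1) ^+ i).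
  exists (fun i : 'I_6 => n3 _ w i), (fun i : 'I_6 => n3 _ ws i).
  split=> [i|].
    have -> : n3 _ w i ++ flatten (n3 _ ws i) =
        n3 _ (fun a b c => w a b c ++ flatten (ws a b c)) i.
      by rewrite /n3; case: nth => [[]].
    rewrite /n3; case: i => [[|[|[|[|[|[|]]]]]] //= _];
      apply/permP => P; rewrite (permP (perm_w _ _ _)) /=; lia.
  rewrite !big_ord_recl big_ord0 /n3 /= /bump /= !exprS expr0.
  rewrite !mulr1 !mulrNN !mulr1 !mulN1r.
  by rewrite opprK !scaleN1r !scale1r /alt3 addr0 !addrA.
move=> x y xs ys' neq_xy; rewrite teval_alt3.
pose r z := if z == y then x else z.
have ry : {in ys, r =1 id}.
  move=> z zs; rewrite /r; case: eqP => // zy; move: uxs; rewrite cat_uniq.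
  by case/and3P => _ /hasPn/(_ _ zs); rewrite zy /= ys'.
have -> : alt3 (fun a b c => teval (fun z => fvar (r z))
      (trace_monomial F (w a b c) (ws a b c))) a b c =
    alt3 (fun a b c => trace_monomial F (w a b c) (ws a b c))
      (r a) (r b) (r c).
  have wr a' b' c' : teval (fun z => fvar (r z))
      (trace_monomial F (w a' b' c') (ws a' b' c')) =
      trace_monomial F (w (r a') (r b') (r c')) (ws (r a') (r b') (r c')).
    by rewrite teval_rename; have [-> ->] := map_w ry a' b' c'.
  by rewrite /alt3 !wr.
have rxy : r x = r y by rewrite /r eqxx if_same.
move: xs ys'; rewrite !inE => /or3P[] /eqP xE /or3P[] /eqP yE;
  rewrite xE yE ?eqxx // in neq_xy rxy *; rewrite ?rxy -?rxy;
  by rewrite (alt3_12, alt3_13, alt3_23).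
Qed.

End CapelliExamples.

Lemma funext3 (T1 T2 T3 U : Type) (f g : T1 -> T2 -> T3 -> U) :
  (forall x y z, f x y z = g x y z) -> f = g.
Proof. by move=> fg; do 3 (apply/funext => ?); exact: fg. Qed.

Lemma infinite_uniq (X : choiceType) n : infinite_set [set: X] ->
  {s : seq X | uniq s & size s = n}.
Proof.
move=> /(infinite_set_fset n) /cid2[s _ ns].
exists (take n (finmap.enum_fset s)); first exact/take_uniq/finmap.fset_uniq.
by rewrite size_takel.
Qed.

Section Consequences.
Variables (F : fieldType) (X : choiceType) (hX : infinite_set [set: X]).
Variable B : traceAlgType F.
Hypothesis capelliB : forall f : free_trace_alg F X, capelli 3 f ->
  forall e : X -> B, teval e f = 0.

Lemma capelli_standard (a b c : B) : alt3 (fun a b c => a * (b * c)) a b c = 0.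
Proof.
have [[|x1 [|x2 [|x3 [|]]]] //= us _] := infinite_uniq 3 hX.
pose e x := if x == x1 then a else if x == x2 then b else c.
have capE : capelli 3
    (alt3 (fun a b c => trace_monomial F [:: a; b; c] [::]) x1 x2 x3).
  by apply: (@capelli_alt3 F X (fun a b c => [:: a; b; c]) (fun _ _ _ => [::])
    [::] _ _ x1 x2 x3 us) => // a' b' c'; rewrite cats0.
have := capelliB capE e; rewrite teval_alt3.
under [X in alt3 X]funext3 do
  rewrite rmorphM /= teval_word !big_cons !big_nil rmorph1 !mulr1.
move: us; rewrite /= !inE !negb_or -!andbA => /and4P[n12 n13 n23 _].
have e1 : e x1 = a by rewrite /e eqxx.
have e2 : e x2 = b by rewrite /e eq_sym (negPf n12) eqxx.
have e3 : e x3 = c by rewrite /e ![x3 == _]eq_sym (negPf n13) (negPf n23).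
by rewrite /alt3 e1 e2 e3.
Qed.

(** In the standard polynomial at (a, b, 1), four of the six terms cancel and
    the commutator of a and b remains. *)
Lemma capelli_comm : commutative (@GRing.mul B).
Proof.
move=> a b; have := capelli_standard a b 1; rewrite /alt3 !mulr1 !mul1r.
by rewrite subrK addrK; apply: subr0_eq.
Qed.

Lemma capelli_trace (y a b c : B) :
  alt3 (fun a b c => c * (trace a * trace (y * b))) a b c = 0.
Proof.
have [[|x1 [|x2 [|x3 [|z [|]]]]] //= us _] := infinite_uniq 4 hX.
pose e x :=
  if x == x1 then a else if x == x2 then b else if x == x3 then c else y.
have capE : capelli 3 (alt3 (fun a b c =>
    trace_monomial F [:: c] [:: [:: a]; [:: z; b]]) x1 x2 x3).
  apply: (@capelli_alt3 F X (fun _ _ c => [:: c])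
    (fun a b _ => [:: [:: a]; [:: z; b]]) [:: z] _ _ x1 x2 x3 us).
    by move=> a' b' c'; apply/permP => P /=; lia.
  by move=> r rz a' b' c'; split; rewrite /= ?(rz z (mem_head _ _)).
have := capelliB capE e; rewrite teval_alt3.
under [X in alt3 X]funext3 do
  rewrite rmorphM /= teval_word !big_cons !big_nil mulr1 rmorphM /= mulr1
    !teval_trace !teval_word !big_cons !big_nil !mulr1.
move: us; rewrite /= !inE !negb_or -!andbA.
move=> /and5P[n12 n13 n1z n23 /and3P[n2z n3z _]].
have e1 : e x1 = a by rewrite /e eqxx.
have e2 : e x2 = b by rewrite /e eq_sym (negPf n12) eqxx.
have e3 : e x3 = c by rewrite /e ![x3 == _]eq_sym (negPf n13) (negPf n23) eqxx.
have ez : e z = y.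
  by rewrite /e ![z == _]eq_sym (negPf n1z) (negPf n2z) (negPf n3z).
by rewrite /alt3 e1 e2 e3 ez.
Qed.

End Consequences.

(** * The structure of algebras satisfying the identities *)

(** A phantom carrier: the proof of commutativity selects the commutative ring
    structure. *)
Definition commuting (F : fieldType) (B : traceAlgType F)
  (mulBC : commutative (@GRing.mul B)) : Type := B.

HB.instance Definition _ F B mulBC := TraceAlgebra.on (@commuting F B mulBC).
HB.instance Definition _ F B mulBC :=
  GRing.PzRing_hasCommutativeMul.Build (@commuting F B mulBC) mulBC.

(** The two trace algebra structures are not convertible as records, although
    their operations are. *)
Lemma tinterp_commuting (F : fieldType) (B : traceAlgType F) mulBC X
    (e : X -> B) p :
  tinterp (e : X -> @commuting F B mulBC) p = tinterp e p.
Proof.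
elim: p => //= [p IHp p' IHp'|p IHp p' IHp'|p IHp].
- exact: (congr2 (fun a b : B => a + b) IHp IHp').
- exact: (congr2 (fun a b : B => a * b) IHp IHp').
exact: (congr1 (@trace F B) IHp).
Qed.

Lemma in_cat_and (T : eqType) (P : T -> Prop) (s1 s2 : seq T) :
  {in s1 ++ s2, forall x, P x} ->
  {in s1, forall x, P x} /\ {in s2, forall x, P x}.
Proof. by move=> Ps; split=> x xs; apply: Ps; rewrite mem_cat xs ?orbT. Qed.

Section Coordinates.
Variables (F : finFieldType) (lambda : F) (B : traceAlgType F).
Variable mulBC : commutative (@GRing.mul B).
Local Notation K := (commuting mulBC).
Local Notation q := #|F|.
Hypothesis trace1 : trace (1 : K) = lambda%:A.
Hypothesis trace_frob : forall b : K, trace (b ^+ q) = trace 1 * b ^+ q.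
Hypothesis frobB_sqr : forall b : K, (b ^+ q - b) ^+ 2 = 0.
Hypothesis frob_trace : forall b : K, trace b ^+ q = trace b.
Hypothesis trace_frobB : forall b : K,
  trace (b - b ^+ q) ^+ q.-1 * (b - b ^+ q) = b - b ^+ q.
Hypothesis alt3_trace : forall y a b c : K,
  alt3 (fun a b c => c * (trace a * trace (y * b))) a b c = 0.

Lemma frobD (a b : K) : (a + b) ^+ q = a ^+ q + b ^+ q.
Proof. exact: exprDn_pchar (card_pnat K). Qed.

Lemma frobZ c (a : K) : (c *: a) ^+ q = c *: a ^+ q.
Proof. by rewrite exprZn expf_card. Qed.

Lemma frobB (a b : K) : (a - b) ^+ q = a ^+ q - b ^+ q.
Proof. by rewrite frobD -scaleN1r frobZ scaleN1r. Qed.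

Lemma frob_sub (a : K) : (a - a ^+ q) ^+ q = 0.
Proof.
have [m qE] := card_ge2 F; rewrite -opprB -scaleN1r frobZ.
by rewrite [X in _ ^+ X]qE -addn2 exprD frobB_sqr mulr0 scaler0.
Qed.

Lemma frob_idem (a : K) : (a ^+ q) ^+ q = a ^+ q.
Proof. by apply/esym/subr0_eq; rewrite -frobB frob_sub. Qed.

Lemma nil_sqr (n : K) : n ^+ q = 0 -> n * n = 0.
Proof. by move=> n0; have := frobB_sqr n; rewrite n0 sub0r sqrrN expr2. Qed.

Lemma nil_trace (n : K) : n ^+ q = 0 -> trace n ^+ q.-1 * n = n.
Proof. by move=> n0; have := trace_frobB n; rewrite n0 subr0. Qed.

Lemma trace_fix (c : K) : c ^+ q = c -> trace c = lambda *: c.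
Proof. by move=> cq; rewrite -{1}cq trace_frob trace1 -scalerAl mul1r cq. Qed.

Lemma trace_expl k (a b : K) :
  trace (trace a ^+ k * b) = trace a ^+ k * trace b.
Proof.
elim: k b => [|k IHk] b; first by rewrite !mul1r.
by rewrite exprS -mulrA traceM_trace IHk mulrA.
Qed.

(** On multiples of e = t(n)^(q-1), the element t(n) is invertible because e
    is idempotent. *)
Lemma trace_cancel (n x : K) : trace n ^+ q.-1 * x = x ->
  x * trace n ^+ 2 = 0 -> x = 0.
Proof.
have [m ->] := card_ge2 F => /= ex xn0; rewrite -ex -[X in _ * X]ex !exprS.
transitivity (x * trace n ^+ 2 * (trace n ^+ m * trace n ^+ m)); first by ring.
by rewrite xn0 mul0r.
Qed.

(** With D = t(c n) - c t(n), the determinant at the rows 1, c, n and y = n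
    reads D (lambda n - t(n)) = 0.  As n^2 = 0, multiplication by
    lambda n + t(n) leaves D t(n)^2 = 0. *)
Lemma trace_mul_fix (c n : K) : c ^+ q = c -> n ^+ q = 0 ->
  trace (c * n) = c * trace n.
Proof.
move=> cq n0; have := alt3_trace n 1 c n; rewrite /alt3.
rewrite (nil_sqr n0) mulr1 trace1 (trace_fix cq) linear0 -[_ *: c]mulr_algl.
set L := lambda%:A; rewrite (mulrC n c) => H.
apply: subr0_eq; apply: (@trace_cancel n).
  (* D is a multiple of t(n)^(q-1), since n is. *)
  rewrite mulrBr -trace_expl mulrCA nil_trace // mulrCA -exprSr.
  by have [m qE] := card_ge2 F; rewrite {1}qE /= -qE frob_trace.
(* The multiplier is the conjugate of lambda n - t(n), up to sign. *)
rewrite -[RHS](mul0r (- trace n - L * n)) -[in RHS]H.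
by have nn := nil_sqr n0; ring: nn.
Qed.

(** Put k = n m.  The determinant at the rows 1, n, m and y = n, multiplied by
    k, becomes t(n) t(k) k = 0 because n^2 = m^2 = 0.  Both trace factors can
    be removed: k is a multiple of t(k)^(q-1), being in N, and of t(n)^(q-1). *)
Lemma nil_mul (n m : K) : n ^+ q = 0 -> m ^+ q = 0 -> n * m = 0.
Proof.
move=> n0 m0; set k := n * m; have k0 : k ^+ q = 0 by rewrite exprMn n0 mul0r.
have := alt3_trace n 1 n m; rewrite /alt3.
rewrite (nil_sqr n0) mulr1 trace1 linear0 -/k; set L := lambda%:A => H.
have tk : trace n * trace k * k = 0.
  rewrite -[RHS](mul0r k) -[in RHS]H /k.
  by have nn := nil_sqr n0; have mm := nil_sqr m0; ring: nn mm.
rewrite /k -(nil_trace n0) -mulrA -/k -(nil_trace k0).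
have [r ->] := card_ge2 F; rewrite /= !exprS.
transitivity ((trace n * trace k * k) * (trace n ^+ r * trace k ^+ r)).
  by ring.
by rewrite tk mul0r.
Qed.

(** Multiplicativity of b |-> b^q + t(b - b^q) v into the dual numbers
    over C. *)
Lemma frob_mul_trace (a b : K) : trace (a * b - (a * b) ^+ q) =
  a ^+ q * trace (b - b ^+ q) + trace (a - a ^+ q) * b ^+ q.
Proof.
rewrite -[trace (a - _) * _]mulrC.
rewrite -!trace_mul_fix ?frob_idem ?frob_sub // -linearD; congr trace.
have := nil_mul (frob_sub a) (frob_sub b); rewrite exprMn.
set c := a ^+ q; set d := b ^+ q => H.
by apply: subr0_eq; rewrite -[RHS]H; ring.
Qed.

Lemma traceE (a : K) : trace a = lambda *: a ^+ q + trace (a - a ^+ q).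
Proof. by rewrite linearB /= (trace_fix (frob_idem a)) addrC subrK. Qed.

(** Injectivity of b |-> b^q + t(b - b^q) v. *)
Lemma coords_inj (a : K) : a ^+ q = 0 -> trace (a - a ^+ q) = 0 -> a = 0.
Proof.
move=> a0; rewrite a0 subr0 => ta0; rewrite -(nil_trace a0) ta0.
by have [m ->] := card_ge2 F; rewrite /= exprS !mul0r.
Qed.

Lemma prod_fixB (c : K) : c ^+ q = c -> \prod_alpha (c - alpha%:A) = 0 :> K.
Proof.
move=> cq.
have := congr1 (fun p => (map_poly (in_alg K) p).[c]) (finField_genPoly F).
rewrite rmorphB /= map_polyXn map_polyX !hornerE cq subrr => ->.
rewrite rmorph_prod horner_prod; apply: eq_bigr => alpha _.
by rewrite /= map_polyXsubC hornerXsubC.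
Qed.

(** On the fixed elements of the Frobenius map, this behaves as the
    characteristic function of c = alpha. *)
Definition indicator (alpha : F) (c : K) : K := 1 - (c - alpha%:A) ^+ q.-1.

(** If all indicators kill g, then g = (c - alpha)^(q-1) g for every alpha, and
    the product of these factors over F is (c^q - c)^(q-1) = 0. *)
Lemma indicator_split (c g : K) : c ^+ q = c ->
  (forall alpha, indicator alpha c * g = 0) -> g = 0.
Proof.
rewrite /indicator => cq g0; have [m qE] := card_ge2 F.
transitivity ((\prod_alpha (c - alpha%:A)) ^+ q.-1 * g); last first.
  by rewrite prod_fixB // qE /= exprS !mul0r.
rewrite -prodrXl; elim/big_rec: _ => [|alpha x _ IHx]; first by rewrite mul1r.
by apply: subr0_eq; rewrite -mulrA -{}IHx -{1}[g]mul1r -mulrBl.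
Qed.

Lemma indicator_mul (c : K) alpha : c ^+ q = c ->
  indicator alpha c * c = alpha *: indicator alpha c.
Proof.
move=> cq; have [m qE] := card_ge2 F.
rewrite -mulr_algr; apply: subr0_eq; rewrite -mulrBr mulrBl mul1r.
have -> : (c - alpha%:A) ^+ q.-1 * (c - alpha%:A) = (c - alpha%:A) ^+ q.
  by rewrite -exprSr qE.
by rewrite frobB frobZ expr1n cq subrr.
Qed.

(** On the part of K selected by E, the coordinates of b in C are the constant
    coordinates of a. *)
Definition match_coords (E b : K) (a : dual_numbers lambda) :=
  exists a0 a1 : F, [/\ a = a0%:A + a1 *: dual_v lambda,
    E * b ^+ q = a0 *: E & E * trace (b - b ^+ q) = a1 *: E].

Lemma match_coordsM E' E b a : match_coords E b a -> match_coords (E' * E) b a.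
Proof.
move=> [a0 [a1 [-> E0 E1]]]; exists a0, a1.
by split; rewrite // -mulrA ?E0 ?E1 scalerAr.
Qed.

Fixpoint tvars (X : eqType) (p : tterm F X) : seq X :=
  match p with
  | TVar x => [:: x]
  | TConst _ => [::]
  | TAdd p1 p2 | TMul p1 p2 => tvars p1 ++ tvars p2
  | TTrace p1 => tvars p1
  end.

(** The coordinates form a trace morphism into the dual numbers over C, so a
    match on the variables propagates to all terms. *)
Lemma match_interp (X : eqType) (E : K) (eK : X -> K)
    (e : X -> dual_numbers lambda) (p : tterm F X) :
  {in tvars p, forall x, match_coords E (eK x) (e x)} ->
  match_coords E (tinterp eK p) (tinterp e p).
Proof.
elim: p => [x|c|p1 IH1 p2 IH2|p1 IH1 p2 IH2|p1 IH1] /= Ee.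
- by apply: Ee; rewrite mem_seq1.
- exists c, 0; rewrite scale0r addr0 frobZ expr1n subrr linear0 mulr0 scale0r.
  by split=> //; rewrite mulr_algr.
- have [/IH1[a0 [a1 [-> E0 E1]]] /IH2[b0 [b1 [-> E2 E3]]]] := in_cat_and Ee.
  exists (a0 + b0), (a1 + b1); split.
  + by rewrite !scalerDl addrACA.
  + by rewrite frobD mulrDr E0 E2 scalerDl.
  by rewrite frobD opprD addrACA linearD mulrDr /= E1 E3 scalerDl.
- have [/IH1[a0 [a1 [-> E0 E1]]] /IH2[b0 [b1 [-> E2 E3]]]] := in_cat_and Ee.
  exists (a0 * b0), (a0 * b1 + a1 * b0); split.
  + rewrite mulrDl !mulrDr -!scalerAl -!scalerAr !mul1r mulr1.
    rewrite -[dual_v _ * dual_v _]expr2 dual_v_sqr !scaler0 addr0 !scalerA.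
    by rewrite -addrA -scalerDl.
  + by rewrite exprMn mulrA E0 -scalerAl E2 scalerA.
  rewrite frob_mul_trace mulrDr !mulrA E0 E1 -!scalerAl E2 E3 !scalerA.
  by rewrite scalerDl.
have /IH1[a0 [a1 [-> E0 E1]]] := Ee.
exists (lambda * a0 + a1), 0; split.
- by rewrite scale0r addr0 dual_trace_coords.
- by rewrite frob_trace traceE mulrDr E1 -scalerAr E0 scalerA scalerDl.
by rewrite frob_trace subrr linear0 mulr0 scale0r.
Qed.

(** The products of indicators over the coordinates of finitely many elements
    cover K: only they need to be tested to prove g = 0. *)
Lemma match_cover (X : eqType) (eK : X -> K) (s : seq X) (g : K) :
  (forall E e, {in s, forall x, match_coords E (eK x) (e x)} -> E * g = 0) ->
  g = 0.
Proof.
elim: s g => [|x s IHs] g Eg; first by rewrite -[g]mul1r (Eg 1 (fun=> 0)).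
apply: IHs => E e Ee.
apply: (indicator_split (frob_idem (eK x))) => a0.
apply: (indicator_split (frob_trace (eK x - eK x ^+ q))) => a1.
set d1 := indicator a1 _; set d0 := indicator a0 _; rewrite mulrA mulrA.
apply: Eg (fun z => if z == x then a0%:A + a1 *: dual_v lambda else e z) _ => z.
rewrite inE; have [-> _|_ /= zs] := eqVneq z x; last first.
  exact/match_coordsM/Ee.
exists a0, a1; split=> //.
  have -> : d1 * d0 * E = d1 * E * d0 by ring.
  by rewrite -mulrA indicator_mul ?frob_idem // scalerAr.
have -> : d1 * d0 * E = d0 * E * d1 by ring.
by rewrite -mulrA indicator_mul ?frob_trace // scalerAr.
Qed.

Lemma dual_identity_holds (X : eqType) (p : tterm F X) :
  (forall e : X -> dual_numbers lambda, tinterp e p = 0) ->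
  forall eB : X -> B, tinterp eB p = 0.
Proof.
move=> p0 eB; rewrite -(tinterp_commuting mulBC).
pose eK : X -> K := eB; rewrite -/eK; have coord0 : forall E e,
    {in tvars p, forall x, match_coords E (eK x) (e x)} ->
    E * tinterp eK p ^+ q = 0 /\
    E * trace (tinterp eK p - tinterp eK p ^+ q) = 0.
  move=> E e /match_interp[a0 [a1 [a_0 -> ->]]].
  rewrite p0 in a_0; have [-> ->] := dual_coords_inj (esym a_0).
  by rewrite !scale0r.
apply: coords_inj; apply: (@match_cover _ eK (tvars p)) => E e /coord0[] //.
Qed.

End Coordinates.

(** * Quotients of trace algebras *)

Record proper_trace_ideal (F : fieldType) (A : traceAlgType F) := {
  ideal_set :> A -> Prop;
  ideal0 : ideal_set 0;
  idealD : forall f g, ideal_set f -> ideal_set g -> ideal_set (f + g);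
  idealMl : forall f g, ideal_set g -> ideal_set (f * g);
  idealMr : forall f g, ideal_set f -> ideal_set (f * g);
  ideal_trace : forall f, ideal_set f -> ideal_set (trace f);
  ideal_proper : ~ ideal_set 1
}.

Section Quotient.
Variables (F : fieldType) (A : traceAlgType F) (I : proper_trace_ideal A).

Definition congruent (f g : A) : bool := `[< I (f - g) >].

Lemma idealN f : I f -> I (- f).
Proof. by move=> If; rewrite -mulN1r; apply: idealMl. Qed.

Lemma congruent_refl : reflexive congruent.
Proof. by move=> f; apply/asboolP; rewrite subrr; exact: ideal0. Qed.

Lemma congruent_sym : symmetric congruent.
Proof.
by move=> f g; apply/asboolP/asboolP => /idealN; rewrite opprB.
Qed.

Lemma congruent_trans : transitive congruent.
Proof.
move=> g f h /asboolP fg /asboolP gh; apply/asboolP.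
by rewrite -[f](subrK g) -addrA; apply: idealD.
Qed.

Canonical congruent_equiv :=
  EquivRel congruent congruent_refl congruent_sym congruent_trans.

Definition trace_quotient : Type := {eq_quot congruent_equiv}%qT.
Local Notation Q := trace_quotient.

HB.instance Definition _ := Choice.on Q.
HB.instance Definition _ := Quotient.on Q.

Definition quotient_map (f : A) : Q := (\pi_Q f)%qT.
Local Notation "[ f ]" := (quotient_map f).

Lemma quotient_eq f g : [f] = [g] <-> I (f - g).
Proof.
have eqP' := @eqquotP _ congruent_equiv {eq_quot congruent_equiv}%qT.
by split=> [/eqP'/asboolP //|h]; apply/eqP'/asboolP.
Qed.

Lemma quotient_ind (P : Q -> Prop) : (forall f, P [f]) -> forall x, P x.
Proof. by move=> Pq x; rewrite -[x]reprK; apply: Pq. Qed.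

Lemma repr_congr f : I (repr [f] - f).
Proof. by apply/quotient_eq; rewrite /quotient_map reprK. Qed.

Definition qadd (x y : Q) : Q := [repr x + repr y].
Definition qopp (x : Q) : Q := [- repr x].
Definition qmul (x y : Q) : Q := [repr x * repr y].
Definition qscale (c : F) (x : Q) : Q := [c *: repr x].
Definition qtrace (x : Q) : Q := [trace (repr x)].

Lemma qaddE f g : qadd [f] [g] = [f + g].
Proof.
by apply/quotient_eq; rewrite opprD addrACA; apply: idealD; apply: repr_congr.
Qed.

Lemma qoppE f : qopp [f] = [- f].
Proof. by apply/quotient_eq; rewrite -opprD; apply/idealN/repr_congr. Qed.

Lemma qmulE f g : qmul [f] [g] = [f * g].
Proof.
apply/quotient_eq; set f' := repr _; set g' := repr _.
have -> : f' * g' - f * g = (f' - f) * g' + f * (g' - g).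
  by rewrite mulrBl mulrBr addrA subrK.
by apply: idealD; [apply: idealMr | apply: idealMl]; apply: repr_congr.
Qed.

Lemma qscaleE c f : qscale c [f] = [c *: f].
Proof.
apply/quotient_eq; rewrite -scalerBr -mulr_algl.
by apply/idealMl/repr_congr.
Qed.

Lemma qtraceE f : qtrace [f] = [trace f].
Proof.
by apply/quotient_eq; rewrite -linearB; apply/ideal_trace/repr_congr.
Qed.

Let qE := (qaddE, qoppE, qmulE, qscaleE, qtraceE).

Fact qadd_assoc : associative qadd.
Proof.
elim/quotient_ind=> f; elim/quotient_ind=> g; elim/quotient_ind=> h.
by rewrite !qE addrA.
Qed.
Fact qadd_comm : commutative qadd.
Proof. by elim/quotient_ind=> f; elim/quotient_ind=> g; rewrite !qE addrC. Qed.
Fact qadd_0l : left_id [0] qadd.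
Proof. by elim/quotient_ind=> f; rewrite !qE add0r. Qed.
Fact qadd_Nl : left_inverse [0] qopp qadd.
Proof. by elim/quotient_ind=> f; rewrite !qE addNr. Qed.

HB.instance Definition _ :=
  GRing.isZmodule.Build Q qadd_assoc qadd_comm qadd_0l qadd_Nl.

Fact qmul_assoc : associative qmul.
Proof.
elim/quotient_ind=> f; elim/quotient_ind=> g; elim/quotient_ind=> h.
by rewrite !qE mulrA.
Qed.
Fact qmul_1l : left_id [1] qmul.
Proof. by elim/quotient_ind=> f; rewrite !qE mul1r. Qed.
Fact qmul_1r : right_id [1] qmul.
Proof. by elim/quotient_ind=> f; rewrite !qE mulr1. Qed.
Fact qmul_Dl : left_distributive qmul +%R.
Proof.
elim/quotient_ind=> f; elim/quotient_ind=> g; elim/quotient_ind=> h.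
by rewrite -![_ + _]/(qadd _ _) !qE mulrDl.
Qed.
Fact qmul_Dr : right_distributive qmul +%R.
Proof.
elim/quotient_ind=> f; elim/quotient_ind=> g; elim/quotient_ind=> h.
by rewrite -![_ + _]/(qadd _ _) !qE mulrDr.
Qed.
Fact qone_neq0 : [1] != 0 :> Q.
Proof. by apply/eqP => /quotient_eq; rewrite subr0; apply: ideal_proper. Qed.

HB.instance Definition _ := GRing.Zmodule_isNzRing.Build Q
  qmul_assoc qmul_1l qmul_1r qmul_Dl qmul_Dr qone_neq0.

Fact qscale_A (c d : F) x : qscale c (qscale d x) = qscale (c * d) x.
Proof. by elim/quotient_ind: x => f; rewrite !qE scalerA. Qed.
Fact qscale_1 : left_id 1 qscale.
Proof. by elim/quotient_ind=> f; rewrite !qE scale1r. Qed.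
Fact qscale_Dr : right_distributive qscale +%R.
Proof.
move=> c; elim/quotient_ind=> f; elim/quotient_ind=> g.
by rewrite -![_ + _]/(qadd _ _) !qE scalerDr.
Qed.
Fact qscale_Dl x : {morph qscale^~ x : c d / c + d}.
Proof.
elim/quotient_ind: x => f c d.
by rewrite -![_ + _ in RHS]/(qadd _ _) !qE scalerDl.
Qed.

HB.instance Definition _ := GRing.Zmodule_isLmodule.Build F Q
  qscale_A qscale_1 qscale_Dr qscale_Dl.

Fact qscale_Al c (x y : Q) : c *: (x * y) = (c *: x) * y.
Proof.
elim/quotient_ind: x => f; elim/quotient_ind: y => g.
by rewrite -![_ *: _]/(qscale _ _) -![_ * _]/(qmul _ _) !qE scalerAl.
Qed.
Fact qscale_Ar c (x y : Q) : c *: (x * y) = x * (c *: y).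
Proof.
elim/quotient_ind: x => f; elim/quotient_ind: y => g.
by rewrite -![_ *: _]/(qscale _ _) -![_ * _]/(qmul _ _) !qE scalerAr.
Qed.

HB.instance Definition _ := GRing.Lmodule_isLalgebra.Build F Q qscale_Al.
HB.instance Definition _ := GRing.Lalgebra_isAlgebra.Build F Q qscale_Ar.

Fact quotient_map_linear : linear quotient_map.
Proof.
move=> c f g.
by rewrite -[_ *: _ in RHS]/(qscale _ _) -[_ + _ in RHS]/(qadd _ _) !qE.
Qed.
Fact quotient_map_monoid_morphism : monoid_morphism quotient_map.
Proof. by split=> [|f g] //; rewrite -[_ * _ in RHS]/(qmul _ _) qmulE. Qed.

HB.instance Definition _ :=
  GRing.isLinear.Build F A Q *:%R quotient_map quotient_map_linear.
HB.instance Definition _ :=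
  GRing.isMonoidMorphism.Build A Q quotient_map quotient_map_monoid_morphism.

Fact qtrace_linear : linear qtrace.
Proof.
move=> c; elim/quotient_ind=> f; elim/quotient_ind=> g.
by rewrite -linearP !qE !linearP.
Qed.
Fact qtrace_central (x y : Q) : qtrace x * y = y * qtrace x.
Proof.
elim/quotient_ind: x => f; elim/quotient_ind: y => g.
by rewrite qtraceE -!rmorphM trace_central.
Qed.
Fact qtraceM_comm (x y : Q) : qtrace (x * y) = qtrace (y * x).
Proof.
elim/quotient_ind: x => f; elim/quotient_ind: y => g.
by rewrite -!rmorphM !qtraceE traceM_comm.
Qed.
Fact qtraceM_trace (x y : Q) : qtrace (qtrace x * y) = qtrace x * qtrace y.
Proof.
elim/quotient_ind: x => f; elim/quotient_ind: y => g.
by rewrite (qtraceE f) (qtraceE g) -!rmorphM qtraceE traceM_trace.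
Qed.

HB.instance Definition _ := Algebra_hasTrace.Build F Q
  qtrace_linear qtrace_central qtraceM_comm qtraceM_trace.

Lemma quotient_map_trace f : [trace f] = trace [f].
Proof. by rewrite -qtraceE. Qed.

End Quotient.

(** * T-ideals and the relatively free algebra *)

Lemma T_ideal_generated_T_ideal (F : fieldType) X
    (S : set (free_trace_alg F X)) :
  T_ideal (T_ideal_generated S).
Proof.
split=> [I|f g If Ig I|f g Ig I|f g If I|f If I|phi phit f If I] [IT SI].
- exact: T_ideal0 IT.
- by apply: (T_idealD IT); [apply: If | apply: Ig].
- by apply: (T_idealMl IT); apply: Ig.
- by apply: (T_idealMr IT); apply: If.
- by apply: (T_ideal_trace IT); apply: If.
by apply: (T_ideal_endo IT) => //; apply: If.
Qed.

(** A Birkhoff-type criterion: the quotient of the free algebra by I satisfies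
    I, because a substitution into the quotient lifts to an endomorphism of the
    free algebra, and f vanishes at its tautological generators exactly when f
    lies in I. *)
Lemma T_ideal_of_quotients (F : fieldType) X (I : set (free_trace_alg F X)) f :
  T_ideal I ->
  (forall B : traceAlgType F,
    (forall g, I g -> forall e : X -> B, teval e g = 0) ->
    forall e : X -> B, teval e f = 0) ->
  I f.
Proof.
move=> IT fB; have [I1|nI1] := pselect (I 1).
  by rewrite -[f]mulr1; apply: T_idealMl.
pose J := Build_proper_trace_ideal (T_ideal0 IT) (T_idealD IT) (T_idealMl IT)
  (T_idealMr IT) (T_ideal_trace IT) nI1.
have evalE e (g : free_trace_alg F X) :
    teval (fun x => quotient_map J (e x)) g = quotient_map J (teval e g).
  by rewrite teval_comp // => a; apply: quotient_map_trace.
suff /fB/(_ (fun x => quotient_map J (fvar x))) :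
    forall g, I g -> forall e : X -> trace_quotient J, teval e g = 0.
  rewrite evalE -[0]/(quotient_map J 0) => /quotient_eq /=; rewrite subr0.
  suff -> : teval (fun x => fvar x : free_trace_alg F X) f = f by [].
  apply: tevalP => A e; rewrite teval_endo; congr teval.
  by apply/funext => x; rewrite teval_var.
move=> g Ig e.
have -> : e = fun x => quotient_map J (repr (e x)).
  by apply/funext => x; rewrite /quotient_map reprK.
rewrite evalE -[RHS]/(quotient_map J 0); apply/quotient_eq; rewrite subr0 /=.
pose e' x : free_trace_alg F X := repr (e x).
have phit (h : free_trace_alg F X) : teval e' (trace h) = trace (teval e' h).
  by rewrite [LHS]teval_trace.
exact: (T_ideal_endo IT phit Ig).
Qed.

Theorem theorem25 (F : finFieldType) (lambda : F) (X : choiceType)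
    (hX : infinite_set [set: X]) (x0 : X) :
  let q := #|F| in
  let x : free_trace_alg F X := fvar x0 in
  trace_identities X (dual_numbers lambda) =
  T_ideal_generated (
    [set trace 1 - lambda%:A] `|`
    [set trace (x ^+ q) - trace 1 * x ^+ q] `|`
    [set (x ^+ q - x) ^+ 2] `|`
    [set trace x ^+ q - trace x] `|`
    [set trace (x - x ^+ q) ^+ q.-1 * (x - x ^+ q) - (x - x ^+ q)] `|`
    [set f | capelli 3 f]).
Proof.
move=> q x; have [m qE] := card_ge2 F; set S := (X in T_ideal_generated X).
apply/seteqP; split; last first.
  apply: smallest_sub; first exact: T_ideal_identities.
  move=> f [[[[[|]|]|]|]|]; last exact: capelli_identity.
  - by move=> -> e; rewrite linearB linearZ /= teval_trace rmorph1
      trace_dual1 subrr.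
  - move=> -> e; have [c [d ex]] := dual_span (e x0).
    rewrite linearB rmorphM /= !teval_trace rmorphXn rmorph1 /= teval_var ex.
    by rewrite dual_frob linearZ mulr_algr /= subrr.
  - move=> -> e; have [c [d ex]] := dual_span (e x0).
    rewrite rmorphXn rmorphB rmorphXn /= teval_var ex dual_frob.
    by rewrite opprD addrA subrr sub0r sqrrN exprZn dual_v_sqr scaler0.
  - move=> -> e; have [c [d ex]] := dual_span (e x0).
    rewrite linearB rmorphXn /= teval_trace teval_var ex dual_trace_coords.
    by rewrite exprZn expf_card expr1n subrr.
  move=> -> e; have [c [d ex]] := dual_span (e x0).
  rewrite !(rmorphB, rmorphM, rmorphXn) /= teval_trace rmorphB rmorphXn /=.
  rewrite teval_var ex dual_frob addrAC subrr add0r linearZ /= trace_dual_v.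
  rewrite exprZn expr1n -scalerAl mul1r scalerA -exprSr.
  by have -> : q.-1.+1 = q; [rewrite /q qE | rewrite expf_card subrr].
move=> f f0; apply: T_ideal_of_quotients.
  exact: T_ideal_generated_T_ideal.
move=> B genB.
have hB g : S g -> forall e : X -> B, teval e g = 0.
  move=> Sg; apply: genB => I [_]; exact.
have capB g : capelli 3 g -> forall e : X -> B, teval e g = 0.
  by move=> cg; apply: hB; right.
move=> e; refine (@dual_identity_holds F lambda B (capelli_comm hX capB)
  _ _ _ _ _ _ X (repr f) f0 e).
- have /hB/(_ (fun=> 0)) : S (trace 1 - lambda%:A) by do 5 left.
  rewrite linearB linearZ /= teval_trace rmorph1; exact: subr0_eq.
- move=> b; have /hB/(_ (fun=> b)) : S (trace (x ^+ q) - trace 1 * x ^+ q).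
    by do 4 left; right.
  rewrite linearB rmorphM /= !teval_trace rmorphXn rmorph1 /= teval_var.
  exact: subr0_eq.
- move=> b; have /hB/(_ (fun=> b)) : S ((x ^+ q - x) ^+ 2).
    by do 3 left; right.
  by rewrite rmorphXn rmorphB rmorphXn /= teval_var.
- move=> b; have /hB/(_ (fun=> b)) : S (trace x ^+ q - trace x).
    by do 2 left; right.
  rewrite linearB rmorphXn /= teval_trace teval_var; exact: subr0_eq.
- move=> b; have /hB/(_ (fun=> b)) :
      S (trace (x - x ^+ q) ^+ q.-1 * (x - x ^+ q) - (x - x ^+ q)).
    by left; right.
  rewrite !(rmorphB, rmorphM, rmorphXn) /= teval_trace rmorphB rmorphXn /=.
  rewrite teval_var.
  exact: subr0_eq.
exact: (capelli_trace hX capB).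
Qed.
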